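(* Let $G$ be an abelian group of order $a^2b^2$, where $a,b$ are positive integers with $\gcd(a,b)=1$, $a>1$, and $b$ odd with $b\ge 3$. Let $\epsilon\in\{1,-1\}$ and let $D$ be an $(a^2b^2,\ r(ab-\epsilon),\ \epsilon ab+r^2-3\epsilon r,\ r^2-\epsilon r)$-partial difference set in $G$, and let $t$ be the integer with $$t\le \frac{\epsilon ab-2\epsilon r+a}{2a}<t+1.$$ Then: (i) if $\epsilon=1$ (i.e. $D$ is a Latin square type PDS), either $$\frac{(a+1)b(b+1-2t)}{2(b+1)}-(b-1)\le r\le \frac{(a+1)b(b+1-2t)}{2(b+1)}$$ or $$\frac{(a-1)b(b-1-2t)}{2(b-1)}\le r\le \frac{(a-1)b(b-1-2t)}{2(b-1)}+(b+1);$$ (ii) if $\epsilon=-1$ (i.e. $D$ is a negative Latin square type PDS), either $$\frac{(a+1)b(b-1+2t)}{2(b-1)}-(b+1)\le r\le \frac{(a+1)b(b-1+2t)}{2(b-1)}$$ or $$\frac{(a-1)b(b+1+2t)}{2(b+1)}\le r\le \frac{(a-1)b(b+1+2t)}{2(b+1)}+(b-1).$$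
   Context: For a finite abelian group $G$ of order $v$, a subset $D\subseteq G$ of size $k$ is a $(v,k,\lambda,\mu)$-partial difference set (PDS) if the expressions $gh^{-1}$ with $g,h\in D$, $g\ne h$, represent each non-identity element of $D$ exactly $\lambda$ times and each non-identity element of $G\setminus D$ exactly $\mu$ times. A PDS with parameters $(n^2, r(n-\epsilon), \epsilon n+r^2-3\epsilon r, r^2-\epsilon r)$ is of Latin square type if $\epsilon=1$ and of negative Latin square type if $\epsilon=-1$. *)

(* Defs.v *)
From HB Require Import structures.
From mathcomp Require Import all_boot all_order all_fingroup all_algebra.
Set Implicit Arguments. Unset Strict Implicit. Unset Printing Implicit Defensive.
Import Order.TTheory GRing.Theory Num.Theory.

Local Open Scope group_scope.

Definition pds_count (gT : finGroupType) (D : {set gT}) (g : gT) : nat :=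
  #|[set p in setX D D | (p.1 != p.2) && (p.1 * p.2^-1 == g)]|.

Definition is_PDS (gT : finGroupType) (G : {group gT}) (D : {set gT})
    (v : nat) (k lam mu : int) : Prop :=
  [/\ D \subset G, #|G| = v, (Posz #|D| = k) &
      forall g, g \in G -> g != 1 ->
        Posz (pds_count D g) = (if g \in D then lam else mu)].

(* Main.v *)
Require Import Defs.
From HB Require Import structures.
From mathcomp Require Import all_boot all_order all_fingroup all_algebra.
From mathcomp Require Import all_solvable all_field all_character.
From mathcomp Require Import zify ring lra.
Set Implicit Arguments. Unset Strict Implicit. Unset Printing Implicit Defensive.
Import Order.TTheory GRing.Theory Num.Theory.
Local Open Scope ring_scope.

(** If [2 r = a b] then [t = 0] and the bounds hold trivially. Otherwise [D] is
    inverse-closed and misses the identity, so every nontrivial character sum over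
    [D] is [- eps r] or [- eps r + eps a b]. Write [G = N x M] with [#|N| = a^2] and
    [#|M| = b^2]. As the sums are rational, Galois conjugation shows that [D] is
    invariant under [x m |-> x m^-1], and as [#|M|] is odd this yields two families
    of integers with known parities:
    - for [1 <> x \in N], [e x = #|D :&: x M| / b], odd iff [x \in D];
    - for [1 <> psi \in irr N], [i psi], where [- eps r + eps a (i psi)] is the sum
      of [psi] over [D :&: N], odd iff the sum of [psi \x 1] over [D] is
      [- eps r + eps a b].
    Fourier analysis on [N] expresses the first two moments of [e] and [i] by
    [A = (#|D :&: N| + eps r) / a] and [B = (#|D :&: M| + eps r) / b]. The sums of
    [(e - f) (e - f - 1)] and [(i - f) (i - f - 1)] are nonnegative, and so are those
    of [(e - p)^2] and [(i - p)^2] minus the indicator of the classes where the term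
    is odd; taking [f = (b - 1) / 2 - eps t] and [p = f, f + 1], these inequalities
    leave only two possible values for [A]. Finally
    [0 <= eps (b A - r) <= b^2 - 1], because [b^2 #|D :&: N|] is the sum over [D] of
    all the characters of [M]. *)

(** * Preliminaries: coprime factors of an abelian group and parity by involution *)

(** The factors are the Hall subgroups of the nilpotent group [G] for the primes of [m] and for the
    other primes. *)
Lemma abelian_coprime_dprod (gT : finGroupType) (G : {group gT}) (m n : nat) :
  abelian G -> #|G| = (m * n)%N -> coprime m n ->
  exists N M : {group gT}, [/\ (N \x M)%g = G, #|N| = m & #|M| = n].
Proof.
move=> abG oG co_mn; have nilG := abelian_nil abG.
have : (0 < m * n)%N by rewrite -oG.
rewrite muln_gt0 => /andP[m0 n0].
exists 'O_\pi(m)(G)%G, 'O_\pi(m)^'(G)%G.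
have nat_n : \pi(m)^'.-nat n by rewrite -coprime_pi'.
split; first exact: nilpotent_pcoreC.
  rewrite (card_Hall (nilpotent_pcore_Hall _ nilG)) oG partnM //.
  by rewrite part_pnat_id ?pnat_pi // part_p'nat // muln1.
rewrite (card_Hall (nilpotent_pcore_Hall _ nilG)) oG partnM //.
rewrite part_p'nat ?mul1n ?part_pnat_id //.
by apply: (@sub_in_pnat \pi(m)) (pnat_pi m0) => p _; rewrite !inE negbK.
Qed.

(** Induction removing pairs [x], [f x] with [x != z]: only [z] can remain unpaired. *)
Lemma odd_card_involution (T : finType) (A : {set T}) (f : T -> T) (z : T) :
  (forall x, x \in A -> f x \in A) -> (forall x, x \in A -> f (f x) = x) ->
  (forall x, x \in A -> f x = x -> x = z) -> f z = z -> odd #|A| = (z \in A).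
Proof.
move=> fA fK fix_z fz; have [n le_An] := ubnP #|A|.
elim: n A fA fK fix_z le_An => // n IHn A fA fK fix_z; rewrite ltnS => le_An.
have [x /andP[Ax nz]|A0] := pickP [pred x | (x \in A) && (x != z)]; last first.
  have sAz : A \subset [set z].
    by apply/subsetP=> y Ay; have /= := A0 y; rewrite Ay inE => /negbFE.
  by move: sAz; rewrite subset1 => /orP[]/eqP->; rewrite ?cards1 ?cards0 !inE ?eqxx.
have nfx : f x != x by apply/eqP=> /(fix_z x Ax)/eqP; rewrite (negPf nz).
have nfz : f x != z by apply: contraNneq nz => fxz; rewrite -(fK x Ax) fxz fz.
have Afx := fA _ Ax.
have cA : #|A| = #|A :\ x :\ f x|.+2.
  by rewrite (cardsD1 x) Ax (cardsD1 (f x)) !inE nfx Afx.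
have nzA : (z \in A) = (z \in A :\ x :\ f x).
  by rewrite !inE ![z == _]eq_sym nfz nz.
rewrite cA /= negbK nzA; apply: IHn => [y||y|].
- rewrite !inE => /and3P[nyf nyx Ay]; rewrite fA // andbT.
  apply/andP; split.
    by apply: contraNneq nyx => e; rewrite -(fK y Ay) e fK.
  by apply: contraNneq nyf => e; rewrite -e fK.
- by move=> y; rewrite !inE => /and3P[_ _ /fK].
- by rewrite !inE => /and3P[_ _ /fix_z].
by rewrite cA in le_An; lia.
Qed.

(** * Fourier analysis on finite abelian groups *)

Section AbelianFourier.

Variables (gT : finGroupType) (N : {group gT}).
Hypothesis abN : abelian N.

Lemma irr_abelian_lin (j : Iirr N) : 'chi_j \is a linear_char.
Proof. exact/char_abelianP. Qed.

Lemma sum_irr_abelian x : \sum_(j : Iirr N) 'chi_j x = (#|N|%:R *+ (x == 1%g)).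
Proof.
rewrite -cfRegE cfReg_sum sum_cfunE; apply: eq_bigr => j _.
by rewrite cfunE lin_char1 ?mul1r ?irr_abelian_lin.
Qed.

Lemma fourier_inversion (h : gT -> algC) y : y \in N ->
  \sum_(j : Iirr N) (\sum_(x in N) h x * 'chi_j x) * 'chi_j y^-1%g
    = #|N|%:R * h y.
Proof.
move=> Ny; under eq_bigr => j _ do rewrite mulr_suml.
rewrite exchange_big /= (bigD1 y) //= [X in _ + X]big1 ?addr0 => [|x /andP[Nx nxy]].
  under eq_bigr => j _.
    rewrite -mulrA -lin_charM ?irr_abelian_lin ?groupV // mulgV. over.
  by rewrite -mulr_sumr sum_irr_abelian eqxx mulr1n mulrC.
under eq_bigr => j _.
  rewrite -mulrA -lin_charM ?irr_abelian_lin ?groupV //. over.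
rewrite -mulr_sumr sum_irr_abelian.
by rewrite -eq_mulgV1 (negPf nxy) mulr0n mulr0.
Qed.

Lemma fourier_parseval (h : gT -> algC) :
  \sum_(j : Iirr N) (\sum_(x in N) h x * 'chi_j x) *
                    (\sum_(x in N) h x * 'chi_j x^-1%g)
    = #|N|%:R * \sum_(x in N) h x ^+ 2.
Proof.
under eq_bigr => j _ do rewrite mulr_sumr.
rewrite exchange_big mulr_sumr /=; apply: eq_bigr => x Nx.
under eq_bigr => j _ do rewrite mulrCA.
by rewrite -mulr_sumr fourier_inversion // expr2 mulrCA.
Qed.

(** Inversion at the identity and Parseval, with the trivial coefficient split off. Integer
    coefficients equal their conjugates, so Parseval yields plain squares. *)
Lemma fourier_moments (h : gT -> int) (c q : int) (u : Iirr N -> int) :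
  (forall j : Iirr N, j != 0 ->
     \sum_(x in N) (h x)%:~R * 'chi_j x = (c + q * u j)%:~R) ->
  (\sum_(x in N) h x) + \sum_(j : Iirr N | j != 0) (c + q * u j)
     = #|N|%:Z * h 1%g /\
  (\sum_(x in N) h x) ^+ 2 + \sum_(j : Iirr N | j != 0) (c + q * u j) ^+ 2
     = #|N|%:Z * \sum_(x in N) h x ^+ 2.
Proof.
move=> hu.
have h0 : \sum_(x in N) (h x)%:~R * 'chi_(0 : Iirr N) x
    = (\sum_(x in N) h x)%:~R.
  rewrite rmorph_sum /=; apply: eq_bigr => x Nx.
  by rewrite irr0 cfun1E Nx mulr1.
have conj_hat (j : Iirr N) : \sum_(x in N) (h x)%:~R * 'chi_j x^-1%g
    = (\sum_(x in N) (h x)%:~R * 'chi_j x)^*.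
  rewrite rmorph_sum; apply: eq_bigr => x Nx.
  by rewrite rmorphM /= rmorph_int lin_charV_conj ?irr_abelian_lin.
split; apply: (@intr_inj algC).
  have := fourier_inversion (fun x => (h x)%:~R) (group1 N).
  rewrite (bigD1 0) //= h0 invg1 lin_char1 ?irr_abelian_lin // mulr1 => hN.
  rewrite rmorphD rmorphM /= -pmulrn -hN; congr (_ + _).
  rewrite rmorph_sum; apply: eq_bigr => j nz.
  by rewrite hu // lin_char1 ?mulr1 ?irr_abelian_lin.
have := fourier_parseval (fun x => (h x)%:~R).
rewrite (bigD1 0) //= conj_hat h0 rmorph_int -expr2 => hN.
have -> : (#|N|%:Z * \sum_(x in N) h x ^+ 2)%:~R
    = #|N|%:R * \sum_(x in N) ((h x)%:~R : algC) ^+ 2.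
  rewrite rmorphM rmorph_sum /= -pmulrn; congr (_ * _).
  by apply: eq_bigr => x _; rewrite rmorphXn.
rewrite -hN rmorphD rmorphXn; congr (_ + _).
rewrite rmorph_sum; apply: eq_bigr => j nz.
by rewrite conj_hat hu // rmorph_int rmorphXn.
Qed.

End AbelianFourier.

(** * Character sums of partial difference sets *)

Section PartialDifferenceSet.

Variables (gT : finGroupType) (G : {group gT}) (D : {set gT}).
Variables (v : nat) (k lam mu : int).
Hypothesis pdsD : is_PDS G D v k lam mu.

Lemma pds_countV g : pds_count D g^-1%g = pds_count D g.
Proof.
rewrite /pds_count -(@card_imset _ _ (fun p : gT * gT => (p.2, p.1))); last first.
  by move=> [x y] [z w] [-> ->].
apply: eq_card => -[x y]; rewrite !inE /=.
apply/imsetP/idP => [[[z w] /= + [-> ->]]|/andP[/andP[Dx Dy] /andP[nxy /eqP e]]].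
  rewrite !inE /= => /andP[/andP[-> ->] /andP[nzw /eqP e]].
  rewrite eq_sym nzw /=.
  by rewrite -(inj_eq invg_inj) -e invMg invgK.
exists (y, x) => //; rewrite !inE /= Dx Dy eq_sym nxy /=.
by rewrite -e invMg invgK.
Qed.

(** Swapping the two entries of a pair shows that [g] and its inverse are represented equally often;
    as [lam != mu], this count decides membership in [D]. *)
Lemma PDS_symmetric g : lam != mu -> g \in D -> g^-1%g \in D.
Proof.
move=> neq Dg; have [sDG _ _ cD] := pdsD; have Gg := subsetP sDG g Dg.
have [e | n1] := eqVneq g 1%g; first by rewrite e invg1 -e.
apply: contraNT neq => nDg.
have := cD _ Gg n1; have := cD g^-1%g; rewrite groupV invg_eq1 Gg n1 pds_countV.
by move=> /(_ isT isT) ->; rewrite Dg (negPf nDg) => ->.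
Qed.

(** The group-ring equation for the product of [D] and its inverse, evaluated by an arbitrary
    function [F]. *)
Lemma sum_PDS (R : nzRingType) (F : gT -> R) :
  \sum_(g in D) \sum_(h in D) F (g * h^-1)%g
   = k%:~R * F 1%g + lam%:~R * (\sum_(z in D | z != 1%g) F z)
     + mu%:~R * (\sum_(z in G :\: D | z != 1%g) F z).
Proof.
have [sDG _ cardD cD] := pdsD.
rewrite pair_big /= (bigID (fun p : gT * gT => p.1 == p.2)) /= -addrA.
congr (_ + _).
  rewrite -cardD -pmulrn mulr_natl -sumr_const.
  rewrite (reindex (fun g : gT => (g, g))) /=; last first.
    by exists fst => [x|[x y]]; rewrite ?inE //= => /andP[_ /eqP->].
  by apply: eq_big => [g|g _]; rewrite ?eqxx ?andbT ?andbb ?mulgV.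
pose f (p : gT * gT) := (p.1 * p.2^-1)%g.
rewrite (partition_big f (fun z => (z \in G) && (z != 1%g))) /=; last first.
  move=> [x y] /= /andP[/andP[Dx Dy] nxy].
  by rewrite groupM ?groupV ?(subsetP sDG) //= -eq_mulgV1.
have cz z : z \in G -> z != 1%g ->
    \sum_(p : gT * gT | (p.1 \in D) && (p.2 \in D) && (p.1 != p.2) && (f p == z))
       F (p.1 * p.2^-1)%g = (if z \in D then lam else mu)%:~R * F z.
  move=> Gz nz; rewrite -cD // -pmulrn mulr_natl -sumr_const.
  apply: eq_big => [p|p /andP[_ /eqP<-] //].
  by rewrite !inE andbA.
rewrite (eq_bigr (fun z => (if z \in D then lam else mu)%:~R * F z)); last first.
  by move=> z /andP[Gz nz]; exact: cz.
rewrite (bigID (mem D)) /= !mulr_sumr; congr (_ + _).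
  apply: eq_big => [z|z /andP[_ ->] //].
  by case Dz: (z \in D); rewrite ?andbF // (subsetP sDG) // andbT.
apply: eq_big => [z|z /andP[_ /negPf->] //].
by rewrite inE andbC andbA.
Qed.

(** Counting all pairs ([F] constantly 1) with the identity in [D] gives
    [k + lam * (k - 1) + mu * (v - k)]; against the assumed value of [k * k] this forces
    [lam = mu]. *)
Lemma PDS_1notin : lam != mu -> k * k = k + lam * k + mu * (v%:Z - 1 - k) ->
  1%g \notin D.
Proof.
move=> neq kk; apply: contraNN neq => D1.
have [sDG cardG cardD _] := pdsD.
have := @sum_PDS int (fun => 1); rewrite !sumr_const /= !intz.
have -> : #|[pred z in D | z != 1%g]| = #|D :\ 1%g|.
  by apply: eq_card => z; rewrite !inE andbC.
have -> : #|[pred z in G :\: D | z != 1%g]| = #|G :\: D|.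
  apply: eq_card => z; rewrite !inE; have [->|] := eqVneq z 1%g.
    by rewrite D1.
  by rewrite andbT.
have cD1 := cardsD1 1%g D; rewrite D1 /= in cD1.
have := cardsID D G; rewrite (setIidPr sDG) cardG => cGD.
rewrite -mulr_natr !natz cardD mulr1 kk => e.
have {}cD1 : k = 1 + #|(D^#)%g|%:Z by rewrite -cardD cD1.
have {}cGD : v%:Z = k + #|G :\: D|%:Z by rewrite -cGD PoszD cardD.
rewrite cGD {2}cD1 in e.
by apply/eqP; lra.
Qed.

End PartialDifferenceSet.

Lemma sum_irr_neq0 (gT : finGroupType) (G : {group gT}) (j : Iirr G) :
  j != 0 -> \sum_(g in G) 'chi_j g = 0.
Proof.
move=> nz; have := cfdot_irr j 0; rewrite (negPf nz) cfdotE => /eqP.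
rewrite mulf_eq0 invr_eq0 -[_ == 0]/(#|G|%:R == 0) pnatr_eq0.
rewrite -[#|G| == _]negbK -lt0n cardG_gt0 /= => /eqP; rewrite irr0 => {2}<-.
by apply: eq_bigr => g Gg; rewrite cfun1E Gg conjC1 mulr1.
Qed.

(** A nontrivial linear character turns the group-ring equation into a quadratic one: [D] is
    inverse-closed, and the non-identity elements outside [D] contribute [- 1 - S]. *)
Lemma PDS_irr_sq (gT : finGroupType) (G : {group gT}) (D : {set gT}) (v : nat)
    (k lam mu : int) (j : Iirr G) :
  abelian G -> is_PDS G D v k lam mu -> lam != mu -> 1%g \notin D -> j != 0 ->
  let S := \sum_(g in D) 'chi_j g in
  S * S = (k - mu)%:~R + (lam - mu)%:~R * S.
Proof.
move=> abG pdsD neq D1 nz S; have linj := irr_abelian_lin abG j.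
have [sDG _ _ _] := pdsD; have inG := subsetP sDG.
have SV : \sum_(h in D) 'chi_j h^-1%g = S.
  rewrite (reindex_inj invg_inj) /=; apply: eq_big => [g|g _].
    by apply/idP/idP => /(PDS_symmetric pdsD neq); rewrite ?invgK.
  by rewrite invgK.
have nD1 z : z \in D -> z != 1%g by apply: contraTneq => ->.
have := sum_PDS pdsD 'chi_j.
have -> : \sum_(g in D) \sum_(h in D) 'chi_j (g * h^-1)%g = S * S.
  rewrite -{2}SV mulr_suml; apply: eq_bigr => g Dg.
  by rewrite mulr_sumr; apply: eq_bigr => h Dh; rewrite lin_charM ?groupV ?inG.
move=> ->; rewrite lin_char1 // mulr1.
have -> : \sum_(z in D | z != 1%g) 'chi_j z = S.
  by apply: eq_bigl => z; apply/andb_idr/nD1.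
have -> : \sum_(z in G :\: D | z != 1%g) 'chi_j z = - 1 - S.
  have := sum_irr_neq0 nz; rewrite (big_setID D) /= (setIidPr sDG) -/S.
  rewrite (bigD1 1%g) ?inE ?D1 ?group1 //= lin_char1 // => e.
  by apply: (addrI (S + 1)); rewrite -addrA e; ring.
by rewrite !rmorphB /=; ring.
Qed.

(* Apply the automorphism of the algebraic numbers that raises the roots of
   unity of order dividing #|G| to the power k, then invert the Fourier transform. *)
Lemma irr_sum_int_multiplier (gT : finGroupType) (G : {group gT}) (D : {set gT})
    (k : nat) (y : gT) :
  abelian G -> D \subset G -> coprime k #|G| ->
  (forall j : Iirr G, \sum_(g in D) 'chi_j g \is a Num.int) ->
  y \in D -> exists2 g, g \in D & (g ^+ k)%g = y.
Proof.
move=> abG sDG cokG intD Dy; have [u uE] := Qn_aut_exists cokG.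
have inG := subsetP sDG; have linG j := irr_abelian_lin abG j.
have eqD (j : Iirr G) : \sum_(g in D) 'chi_j g = \sum_(g in D) 'chi_j (g ^+ k)%g.
  have /intrP[m Dm] := intD j.
  have <- : u (\sum_(g in D) 'chi_j g) = \sum_(g in D) 'chi_j g.
    by rewrite Dm rmorph_int.
  rewrite rmorph_sum; apply: eq_bigr => g Dg.
  rewrite uE ?lin_charX ?inG // -lin_charX ?inG //.
  by rewrite expg_cardG ?inG // lin_char1.
have Gy := inG _ Dy.
have e1 : \sum_(j : Iirr G) (\sum_(g in D) 'chi_j (g ^+ k)%g) * 'chi_j y^-1%g
    = #|G|%:R.
  under eq_bigr => j _ do rewrite -eqD.
  under eq_bigr => j _ do rewrite mulr_suml.
  rewrite exchange_big /= (bigD1 y) //= [X in _ + X]big1 ?addr0.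
    under eq_bigr => j _ do rewrite -lin_charM ?linG ?groupV // mulgV.
    by rewrite sum_irr_abelian // eqxx.
  move=> g /andP[Dg ngy].
  under eq_bigr => j _ do rewrite -lin_charM ?linG ?groupV ?inG //.
  by rewrite sum_irr_abelian // -eq_mulgV1 (negPf ngy).
(* If no element of [D] had [k]-th power [y], orthogonality would make the sum in [e1] vanish. *)
suff /exists_inP[g Dg /eqP gk] : [exists g in D, (g ^+ k)%g == y] by exists g.
apply: contraT; rewrite negb_exists_in => /forall_inP neD.
have : \sum_(j : Iirr G) (\sum_(g in D) 'chi_j (g ^+ k)%g) * 'chi_j y^-1%g = 0.
  under eq_bigr => j _ do rewrite mulr_suml.
  rewrite exchange_big big1 //= => g Dg.
  under eq_bigr => j _ do rewrite -lin_charM ?linG ?groupV ?groupX ?inG //.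
  by rewrite sum_irr_abelian // -eq_mulgV1 (negPf (neD _ Dg)).
by rewrite e1 => /eqP; rewrite pnatr_eq0 -[_ == _]negbK -lt0n cardG_gt0.
Qed.

(** By the Chinese remainder theorem some power map fixes [N] pointwise and inverts [M]; it is an
    involution whose exponent is prime to [#|G|]. *)
Lemma irr_sum_int_dprodV (gT : finGroupType) (G N M : {group gT}) (D : {set gT}) :
  abelian G -> D \subset G -> (N \x M)%g = G -> coprime #|N| #|M| ->
  (forall j : Iirr G, \sum_(g in D) 'chi_j g \is a Num.int) ->
  {in N & M, forall x m, ((x * m^-1)%g \in D) = ((x * m)%g \in D)}.
Proof.
move=> abG sDG NxM coNM intD.
suff imp x m : x \in N -> m \in M -> (x * m)%g \in D -> (x * m^-1)%g \in D.
  move=> x m Nx Mm; apply/idP/idP; last exact: imp.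
  by rewrite -{2}[m]invgK; apply: imp; rewrite ?groupV.
move=> Nx Mm Dxm; pose k := chinese #|N| #|M| 1 #|M|.-1.
have kN : k = 1 %[mod #|N|] by apply: chinese_modl.
have kM : k = #|M|.-1 %[mod #|M|] by apply: chinese_modr.
have oG : #|G| = (#|N| * #|M|)%N by rewrite (dprod_card NxM).
have cokG : coprime k #|G|.
  rewrite oG coprimeMr -coprime_modl kN coprime_modl coprime1n /=.
  rewrite -coprime_modl kM coprime_modl coprimePn //; exact: cardG_gt0.
have /dprodP[_ defG cNM _] := NxM.
have sNG : {subset N <= G} by apply/subsetP; rewrite -defG mulG_subl.
have sMG : {subset M <= G} by apply/subsetP; rewrite -defG mulG_subr.
have xk z : z \in N -> (z ^+ k)%g = z.
  move=> Nz; rewrite -expg_mod_order -(modn_dvdm _ (order_dvdG Nz)) kN.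
  by rewrite modn_dvdm ?order_dvdG // expg_mod_order.
have mk z : z \in M -> (z ^+ k)%g = z^-1%g.
  move=> Mz; rewrite -expg_mod_order -(modn_dvdm _ (order_dvdG Mz)) kM.
  rewrite modn_dvdm ?order_dvdG // expg_mod_order.
  by apply: (mulgI z); rewrite -expgS prednK ?cardG_gt0 // expg_cardG // mulgV.
have [g Dg gk] := irr_sum_int_multiplier abG sDG cokG intD Dxm.
have Gg := subsetP sDG _ Dg.
have xmk z w : z \in N -> w \in M -> ((z * w) ^+ k)%g = (z * w^-1)%g.
  move=> Nz Mw; rewrite expgMn ?(xk z) ?(mk w) //.
  exact: (commute_sym (centsP cNM w Mw z Nz)).
(* The goal becomes membership of [(g ^+ k) ^+ k], which is [g] itself. *)
rewrite -xmk // -gk.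
move: Dg Gg; rewrite -defG => Dg /mulsgP[x' m' Nx' Mm' defg].
by rewrite defg !xmk ?groupV // invgK -defg.
Qed.

(** * The quadratic inequalities *)

Lemma sum_sqr_le_eq (m w w' : rat) :
  0 <= m -> m <= w -> m <= w' -> w ^+ 2 + w' ^+ 2 <= 2 * m ^+ 2 -> w = m.
Proof. by move=> m0 mw mw' h; apply/eqP; rewrite eq_le mw andbT; nra. Qed.

(** The hypotheses are the Fourier moment identities for [D :&: N] and for the fiber sizes, and the
    total of the fibers. [A] and [B] are the normalizations of [k1] and [d1] in which everything
    else is polynomial. *)
Lemma moments_solve (a b e r k1 d1 I1 I2 S E1 E2 : rat) :
  0 < a -> 0 < b -> e = 1 \/ e = -1 ->
  k1 - (a ^+ 2 - 1) * (e * r) + e * a * I1 = 0 ->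
  k1 ^+ 2 + (a ^+ 2 - 1) * r ^+ 2 - 2 * r * a * I1 + a ^+ 2 * I2 = a ^+ 2 * k1 ->
  r * (a * b - e) - (a ^+ 2 - 1) * (e * r) + e * a * b * S = a ^+ 2 * d1 ->
  r ^+ 2 * (a * b - e) ^+ 2 + (a ^+ 2 - 1) * r ^+ 2
    + (a ^+ 2 * b ^+ 2 - 2 * r * a * b) * S
    = a ^+ 2 * (d1 ^+ 2 + b ^+ 2 * E2) ->
  r * (a * b - e) = d1 + b * E1 ->
  exists A B : rat, [/\ k1 = a * A - e * r, I1 = r * a - e * A,
    I2 = k1 - A ^+ 2 + r ^+ 2, S = e * a * B - e * r &
    E1 = r * a - B /\ E2 = r ^+ 2 + e * a * B - e * r - B ^+ 2].
Proof.
move=> a0 b0 he h1 h2 h3 h4 h5.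
have na : a != 0 by rewrite gt_eqF.
have nb : b != 0 by rewrite gt_eqF.
have ee : e * e = 1 by case: he => ->; ring.
pose A := (k1 + e * r) / a; pose B := (d1 + e * r) / b.
have kA : k1 = a * A - e * r by rewrite /A; field.
have dB : d1 = b * B - e * r by rewrite /B; field.
exists A, B.
have eI1 : I1 = r * a - e * A.
  apply: (mulfI na); rewrite kA in h1.
  by case: he h1 => -> h1; lra.
have eE1 : E1 = r * a - B by apply: (mulfI nb); rewrite dB in h5; lra.
have eS : S = e * a * B - e * r.
  apply: (mulfI (mulf_neq0 na nb)); rewrite dB in h3.
  by case: he h3 => -> h3; lra.
have eI2 : I2 = k1 - A ^+ 2 + r ^+ 2.
  apply: (mulfI (mulf_neq0 na na)); rewrite eI1 kA in h2; rewrite kA.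
  by case: he h2 => -> h2; lra.
split=> //; split=> //.
apply: (mulfI (mulf_neq0 (mulf_neq0 na na) (mulf_neq0 nb nb))).
rewrite dB eS in h4.
by case: he h4 => -> h4; lra.
Qed.

Lemma mul_ge0_between (r s w : rat) :
  r <= s -> 0 <= (w - r) * (s - w) -> r <= w <= s.
Proof. by move=> rs h; apply/andP; split; nra. Qed.

(** Both [w] and [w'] lie between [r] and [c - r]. If [r] is the smaller endpoint, the first sum of
    squares forces equality; otherwise the second does, after reflection in [c]. *)
Lemma between_sum_sqr_eq_left (c r w w' : rat) :
  0 <= r <= c ->
  0 <= (w - r) * (c - r - w) -> 0 <= (w' - r) * (c - r - w') ->
  w ^+ 2 + w' ^+ 2 <= 2 * r ^+ 2 ->
  (c - w) ^+ 2 + (c - w') ^+ 2 <= 2 * (c - r) ^+ 2 -> w = r.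
Proof.
move=> /andP[r0 rc] h h' s1 s2.
have [le|/ltW ge] := lerP r (c - r).
  have /andP[rw _] := mul_ge0_between le h.
  have /andP[rw' _] := mul_ge0_between le h'.
  exact: sum_sqr_le_eq s1.
have /andP[_ rw] : c - r <= w <= r by apply: mul_ge0_between => //; lra.
have /andP[_ rw'] : c - r <= w' <= r by apply: mul_ge0_between => //; lra.
suff : c - w = c - r by lra.
by apply: sum_sqr_le_eq s2; lra.
Qed.

(** The mirror case with [c = a + e]: here the sums of squares force the opposite endpoint. *)
Lemma between_sum_sqr_eq_right (a e r w w' : rat) :
  0 <= r - e -> r <= a ->
  0 <= (w - r) * (a + e - r - w) -> 0 <= (w' - r) * (a + e - r - w') ->
  (w - e) ^+ 2 + (w' - e) ^+ 2 <= 2 * (a - r) ^+ 2 ->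
  (a - w) ^+ 2 + (a - w') ^+ 2 <= 2 * (r - e) ^+ 2 -> w = a + e - r.
Proof.
move=> r0 rc h h' s1 s2.
have [le|/ltW ge] := lerP r (a + e - r).
  have /andP[_ rw] := mul_ge0_between le h.
  have /andP[_ rw'] := mul_ge0_between le h'.
  suff : a - w = r - e by lra.
  by apply: sum_sqr_le_eq s2; lra.
have /andP[rw _] : a + e - r <= w <= r by apply: mul_ge0_between => //; lra.
have /andP[rw' _] : a + e - r <= w' <= r by apply: mul_ge0_between => //; lra.
suff : w - e = a - r by lra.
by apply: sum_sqr_le_eq s1; lra.
Qed.

(* [I1, I2] are the moments of [i], [E1, E2] those of [e], [S] counts the odd
   values of [i] and [k1] those of [e]; [even_form p] and [odd_form p] are the
   parity-corrected sums of squares about an even, resp. odd, center [p]. *)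
Lemma moments_dichotomy (a b e r k1 d1 I1 I2 S E1 E2 f : rat) :
  0 < a -> 0 < b -> e = 1 \/ e = -1 ->
  k1 - (a ^+ 2 - 1) * (e * r) + e * a * I1 = 0 ->
  k1 ^+ 2 + (a ^+ 2 - 1) * r ^+ 2 - 2 * r * a * I1 + a ^+ 2 * I2 = a ^+ 2 * k1 ->
  r * (a * b - e) - (a ^+ 2 - 1) * (e * r) + e * a * b * S = a ^+ 2 * d1 ->
  r ^+ 2 * (a * b - e) ^+ 2 + (a ^+ 2 - 1) * r ^+ 2
    + (a ^+ 2 * b ^+ 2 - 2 * r * a * b) * S
    = a ^+ 2 * (d1 ^+ 2 + b ^+ 2 * E2) ->
  r * (a * b - e) = d1 + b * E1 ->
  let C := a ^+ 2 - 1 in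
  let even_form p := I2 - 2 * p * I1 + p ^+ 2 * C - S
                     + (E2 - 2 * p * E1 + p ^+ 2 * C - k1) in
  let odd_form p := I2 - 2 * p * I1 + p ^+ 2 * C - (C - S)
                     + (E2 - 2 * p * E1 + p ^+ 2 * C - (C - k1)) in
  0 <= I2 - (2 * f + 1) * I1 + f * (f + 1) * C ->
  0 <= E2 - (2 * f + 1) * E1 + f * (f + 1) * C ->
  (0 <= even_form f /\ 0 <= odd_form (f + 1)) \/
  (0 <= odd_form f /\ 0 <= even_form (f + 1)) ->
  0 <= r - f * a -> e <= r - f * a -> r - f * a <= a -> r - f * a <= a + e ->
  exists A : rat, k1 = a * A - e * r /\
    (A - e * f = r - f * a \/ A - e * f = a + e - (r - f * a)).
Proof.
move=> a0 b0 he h1 h2 h3 h4 h5 C even_form odd_form hI hE hT r1 r2 r3 r4.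
have [A [B [kA eI1 eI2 eS [eE1 eE2]]]] := moments_solve a0 b0 he h1 h2 h3 h4 h5.
exists A; split=> //; set r' := r - f * a.
pose w := A - e * f; pose w' := e * (B - f).
(* Adding the form on characters to the form on elements cancels the mixed terms and leaves three
   squares. *)
have evenE p : even_form p
    = 2 * (r - p * a) ^+ 2 - (A - e * p) ^+ 2 - (e * (B - p)) ^+ 2.
  rewrite /even_form eI1 eI2 eS eE1 eE2 kA /C.
  by case: he => ->; ring.
have oddE p : odd_form p
    = 2 * (r - p * a - e) ^+ 2 - (A - e * p - a) ^+ 2 - (e * (B - p) - a) ^+ 2.
  rewrite /odd_form eI1 eI2 eS eE1 eE2 kA /C.
  by case: he => ->; ring.
(* The inequalities for consecutive integers place [w] and [w'] between [r'] and [a + e - r']. *)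
have hw : 0 <= (w - r') * (a + e - r' - w).
  move: hI; rewrite eI1 eI2 kA /C /w /r'.
  by case: he => ->; lra.
have hw' : 0 <= (w' - r') * (a + e - r' - w').
  move: hE; rewrite eE1 eE2 /C /w' /r'.
  by case: he => ->; lra.
case: hT => -[]; rewrite evenE oddE => t1 t2; [left|right].
  apply: (@between_sum_sqr_eq_left (a + e) r' w w') => //.
  - by rewrite r1 r4.
  - by rewrite /w /w' /r'; lra.
  - by move: t2; rewrite /w /w' /r'; case: he => ->; lra.
apply: (@between_sum_sqr_eq_right a e r' w w') => //; first by rewrite subr_ge0.
- by move: t2; rewrite /w /w' /r'; case: he => ->; lra.
by move: t1; rewrite /w /w' /r'; case: he => ->; lra.
Qed.

(** * Splitting the group into coprime factors *)

(** A rational algebraic integer is an integer, so divisibility among algebraic integers descends to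
    [int]. *)
Lemma Aint_int_dvdz (m n : int) (z : algC) :
  m != 0 -> z \in Aint -> n%:~R = m%:~R * z -> exists q : int,
  z = q%:~R /\ n = m * q.
Proof.
move=> nz Az e; have nzC : (m%:~R : algC) != 0 by rewrite intr_eq0.
have /intrP[q zq] : z \is a Num.int.
  apply: Cint_rat_Aint Az.
  have -> : z = n%:~R / m%:~R by rewrite e mulrAC divff ?mul1r.
  by rewrite rpred_div ?Crat_int // rpred_int.
exists q; split=> //; apply: (@intr_inj algC).
by rewrite e zq rmorphM.
Qed.

Lemma sum_affine (I : finType) (P : pred I) (u : I -> int) (c q : int) :
  \sum_(i | P i) (c + q * u i) = #|P|%:Z * c + q * \sum_(i | P i) u i.
Proof. by rewrite big_split sumr_const -mulr_natl natz mulr_sumr. Qed.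

Lemma sum_sqr_affine (I : finType) (P : pred I) (u : I -> int) (c q : int) :
  \sum_(i | P i) (c + q * u i) ^+ 2
    = #|P|%:Z * c ^+ 2 + 2 * c * q * \sum_(i | P i) u i
      + q ^+ 2 * \sum_(i | P i) u i ^+ 2.
Proof.
rewrite (eq_bigr (fun i => (c ^+ 2 + (2 * c * q) * u i) + q ^+ 2 * u i ^+ 2)).
  by rewrite big_split sum_affine mulr_sumr.
by move=> i _; ring.
Qed.

(** Opposite parities force [x] and [p] to differ, and a nonzero integer square is at least 1. *)
Lemma sqr_sub_parity_ge (x : nat) (p : int) (s : bool) :
  odd x (+) odd `|p|%N = s -> 0 <= (x%:Z - p) ^+ 2 - s%:Z.
Proof.
case: s => par; last by rewrite subr0 sqr_ge0.
have nz : x%:Z - p != 0.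
  by apply/negP=> /eqP/subr0_eq px; move: par; rewrite -px /= addbb.
have : 0 < (x%:Z - p) ^+ 2 by rewrite lt_neqAle eq_sym sqrf_eq0 nz sqr_ge0.
by rewrite subr_ge0.
Qed.

Lemma odd_abszS (f : int) : odd `|(f + 1)%R|%N = ~~ odd `|f|%N.
Proof. by lia. Qed.

(** No integer lies strictly between [f] and [f + 1]. *)
Lemma mul_sub_succ_ge0 (x f : int) : 0 <= (x - f) * (x - f - 1).
Proof.
have [le|] := lerP x f; first by apply: mulr_le0; lia.
by rewrite -lezD1 => gt; apply: mulr_ge0; lia.
Qed.

Section CoprimeSplit.

Variables (gT : finGroupType) (G N M : {group gT}) (D : {set gT}).
Variables (a b : nat) (eps r : int).
Hypotheses (abG : abelian G) (NxM : (N \x M)%g = G).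
Hypotheses (oN : #|N| = (a ^ 2)%N) (oM : #|M| = (b ^ 2)%N).
Hypotheses (co_ab : coprime a b) (a0 : (0 < a)%N) (odd_b : odd b).
Hypothesis heps : eps = 1 \/ eps = -1.
Hypotheses (sDG : D \subset G) (D1 : 1%g \notin D).
Hypothesis cardD : #|D|%:Z = r * ((a * b)%N%:Z - eps).
Hypothesis irrD : forall j : Iirr G, j != 0 -> exists s : bool,
  \sum_(g in D) 'chi_j g = (- (eps * r) + eps * (a * b)%N%:Z * s%:Z)%:~R.

(** [D :&: x M] translated into [M], where inversion can act on it. *)
Definition fiber (x : gT) := [set m in M | (x * m)%g \in D].

Definition prod_sum (j : Iirr N) (l : Iirr M) : algC :=
  \sum_(g in D) cfDprod NxM 'chi_j 'chi_l g.

(* The dual partial difference set, as a relation between [irr N] and [irr M]. *)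
Definition high (j : Iirr N) (l : Iirr M) : bool :=
  prod_sum j l == (- (eps * r) + eps * (a * b)%N%:Z)%:~R.

Let sNG : N \subset G.
Proof. by have /dprodP[_ <- _ _] := NxM; rewrite mulG_subl. Qed.
Let sMG : M \subset G.
Proof. by have /dprodP[_ <- _ _] := NxM; rewrite mulG_subr. Qed.
Let abN : abelian N. Proof. exact: abelianS sNG abG. Qed.
Let abM : abelian M. Proof. exact: abelianS sMG abG. Qed.
Let b0 : (0 < b)%N. Proof. by case: b odd_b. Qed.
Let odd_M : odd #|M|. Proof. by rewrite oM oddX odd_b orbT. Qed.

Lemma sum_dprod (F : gT -> algC) : \sum_(g in D) F g =
  \sum_(x in N) \sum_(m in M) ((x * m)%g \in D)%:R * F (x * m)%g.
Proof.
rewrite -(reindex_dprod NxM _ (fun g => (g \in D)%:R * F g)) /=.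
rewrite [RHS](big_setID D) /= (setIidPr sDG) [X in _ + X]big1 ?addr0 => [|g].
  by apply: eq_bigr => g ->; rewrite mul1r.
by rewrite inE => /andP[/negPf-> _]; rewrite mul0r.
Qed.

Lemma prod_sumE j l : (j != 0) || (l != 0) ->
  prod_sum j l = (- (eps * r) + eps * (a * b)%N%:Z * (high j l)%:Z)%:~R.
Proof.
rewrite -negb_and -(dprod_Iirr_eq0 NxM) => /irrD[s].
rewrite dprod_IirrE -/(prod_sum j l) => e.
have [/eqP-> | nh] := boolP (high j l); first by rewrite mulr1.
by case: s e => // e; rewrite /high e mulr1 eqxx in nh.
Qed.

Lemma irr_sum_int (j : Iirr G) : \sum_(g in D) 'chi_j g \is a Num.int.
Proof.
have [-> | /irrD[s ->]] := eqVneq j 0; last exact: rpred_int.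
rewrite irr0 (eq_bigr (fun=> 1)) ?sumr_const ?rpred_nat // => g /(subsetP sDG) Gg.
by rewrite cfun1E Gg.
Qed.

Lemma fiberV x m : x \in N -> m \in M ->
  ((x * m^-1)%g \in D) = ((x * m)%g \in D).
Proof.
have coNM : coprime #|N| #|M| by rewrite oN oM coprimeXl // coprimeXr.
exact: (irr_sum_int_dprodV abG sDG NxM coNM irr_sum_int).
Qed.

(** Inversion acts on the fiber, and in the odd-order group [M] it fixes only the identity. *)
Lemma odd_fiber x : x \in N -> odd #|fiber x| = (x \in D).
Proof.
move=> Nx; rewrite (@odd_card_involution _ _ (fun m => m^-1%g) 1%g) ?invg1 //.
- by rewrite inE group1 mulg1.
- by move=> m; rewrite !inE groupV => /andP[Mm]; rewrite fiberV ?Mm.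
- by move=> m; rewrite invgK.
move=> m; rewrite inE => /andP[Mm _] mV; apply/eqP; rewrite -order_eq1 -dvdn1.
have <- : gcdn 2 #|M| = 1%N by apply/eqP; rewrite -/(coprime 2 _) coprime2n.
by rewrite dvdn_gcd order_dvdG // order_dvdn andbT expgS expg1 -{1}mV mulVg.
Qed.

Lemma fiber_fourier (j : Iirr N) :
  \sum_(x in N) #|fiber x|%:Z%:~R * 'chi_j x = prod_sum j 0.
Proof.
rewrite /prod_sum sum_dprod; apply: eq_bigr => x Nx.
rewrite -pmulrn -sum1_card natr_sum mulr_suml big_mkcond [RHS]big_mkcond /=.
apply: eq_bigr => m _; rewrite inE.
case Mm: (m \in M) => //=; rewrite cfDprodE // irr0 cfun1E Mm mulr1.
by case: ifP; rewrite ?mul0r.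
Qed.

(** Summing over all characters of [M] kills the elements with nontrivial [M]-component and leaves
    those of [D :&: N]. *)
Lemma inter_fourier (j : Iirr N) :
  \sum_(l : Iirr M) prod_sum j l
    = (b ^ 2)%N%:R * \sum_(x in N) (x \in D)%:Z%:~R * 'chi_j x.
Proof.
under eq_bigr => l _ do rewrite /prod_sum sum_dprod.
rewrite exchange_big mulr_sumr /=; apply: eq_bigr => x Nx.
rewrite exchange_big (bigD1 1%g) //= [X in _ + X]big1 ?addr0 => [|m /andP[Mm n1]].
  under eq_bigr => l _ do rewrite cfDprodE //.
  rewrite -mulr_sumr mulg1 -mulr_sumr sum_irr_abelian // eqxx oM -pmulrn.
  by rewrite mulr1n; ring.
under eq_bigr => l _ do rewrite cfDprodE //.
by rewrite -mulr_sumr -mulr_sumr sum_irr_abelian // (negPf n1) !mulr0.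
Qed.

Definition num_high (j : Iirr N) := #|[set l | high j l]|.

Lemma high_conj j l : high j (conjC_Iirr l) = high j l.
Proof.
rewrite /high; congr (_ == _); rewrite /prod_sum !sum_dprod.
apply: eq_bigr => x Nx; rewrite (reindex_inj invg_inj) /=.
apply: eq_big => [m|m]; rewrite groupV // => Mm.
rewrite fiberV // !cfDprodE ?groupV // conjC_IirrE cfConjCE.
by rewrite -lin_charV_conj ?irr_abelian_lin ?groupV // invgK.
Qed.

(** A real linear character is 1 on squares, and every element of a group of odd order is a
    square. *)
Lemma conjC_Iirr_odd (l : Iirr M) : conjC_Iirr l = l -> l = 0.
Proof.
move=> ll; apply/eqP; rewrite -irr_eq1; apply/eqP/cfun_inP => m Mm.
have linl := irr_abelian_lin abM l.
have sq1 y : y \in M -> 'chi_l (y ^+ 2)%g = 1.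
  move=> My; rewrite expgS expg1 lin_charM // -{1}ll conjC_IirrE cfConjCE.
  by rewrite -lin_charV_conj // -lin_charM ?groupV // mulVg lin_char1.
have -> : m = ((m ^+ (#|M|.+1)./2) ^+ 2)%g.
  have evenM : ~~ odd #|M|.+1 by rewrite /= odd_M.
  rewrite -expgM muln2 (even_halfK evenM).
  by rewrite expgS expg_cardG // mulg1.
by rewrite sq1 ?groupX // cfun1E groupX ?groupX.
Qed.

Lemma odd_num_high j : odd (num_high j) = high j 0.
Proof.
rewrite (@odd_card_involution _ _ (@conjC_Iirr _ M) 0) ?inE //.
- by move=> l; rewrite !inE high_conj.
- by move=> l _; rewrite conjC_IirrK.
- by move=> l _; apply: conjC_Iirr_odd.
by rewrite conjC_Iirr0.
Qed.

Lemma sum_high j (P : pred (Iirr M)) :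
  (forall l, P l -> (j != 0) || (l != 0)) ->
  \sum_(l | P l) prod_sum j l = (- (eps * r) * #|P|%:Z
     + eps * (a * b)%N%:Z * #|[set l | P l & high j l]|%:Z)%:~R.
Proof.
move=> hP; rewrite (eq_bigr _ (fun l Pl => prod_sumE (hP l Pl))) -rmorph_sum /=.
congr (_ %:~R); rewrite big_split /= sumr_const -mulr_sumr -mulr_natr natz.
congr (_ + _ * _); rewrite -[RHS]natz -sum1_card natr_sum.
rewrite big_mkcond [RHS]big_mkcond /=.
by apply: eq_bigr => l _; rewrite inE; case: (P l); case: (high j l).
Qed.

Lemma epsK (x : int) : eps * (eps * x) = x.
Proof. by case: heps => ->; rewrite ?mul1r // !mulN1r opprK. Qed.

(** Inserting the two possible values of [prod_sum] into [inter_fourier] and cancelling [b] gives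
    [a * num_high j = b * y] with [y] an algebraic integer; as [a] and [b] are coprime, [b] divides
    [num_high j]. *)
Lemma inter_value j : j != 0 -> (b %| num_high j)%N /\
  \sum_(x in N) (x \in D)%:Z%:~R * 'chi_j x
    = (- (eps * r) + eps * a%:Z * (num_high j %/ b)%N%:Z)%:~R.
Proof.
move=> nz; set z := \sum_(x in N) _.
have Az : z \in Aint.
  apply: rpred_sum => x _; apply: rpredM; last exact: Aint_irr.
  by rewrite rpred_int.
have := inter_fourier j; rewrite (@sum_high j predT) ?nz // -/z.
rewrite -[#|_|]/(num_high j) card_Iirr_abelian // oM => e.
pose y : algC := eps%:~R * (z + (eps * r)%:~R).
have Ay : y \in Aint by rewrite rpredM ?rpredD ?rpred_int.
have nzb : b%:Z != 0 by rewrite eqz_nat -lt0n.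
have ey : (a%:Z * (num_high j)%:Z)%:~R = (b%:Z)%:~R * y.
  have nzbC : (b%:Z%:~R : algC) != 0 by rewrite intr_eq0.
  apply: (mulfI nzbC).
  have -> : b%:Z%:~R * (b%:Z%:~R * y)
      = eps%:~R * ((b ^ 2)%:R * z) + (b ^ 2)%:R * (eps * (eps * r))%:~R.
    by rewrite /y; ring.
  rewrite -e epsK; have := epsK ((a * b)%N%:Z * (num_high j)%:Z).
  have := epsK (r * (b ^ 2)%N%:Z).
  move=> /(congr1 (fun n : int => n%:~R : algC)) e1.
  move=> /(congr1 (fun n : int => n%:~R : algC)) e2.
  transitivity (((a * b)%N%:Z * (num_high j)%:Z)%:~R : algC); first by ring.
  transitivity (- (eps * (eps * (r * (b ^ 2)%N)))%:~R
     + (eps * (eps * ((a * b)%N * num_high j)))%:~R + (r * (b ^ 2)%N%:Z)%:~R : algC).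
    by rewrite e1 e2; ring.
  by ring.
have [q [yq abq]] := Aint_int_dvdz nzb Ay ey.
have bh : (b %| num_high j)%N.
  have : (b%:Z %| a%:Z * (num_high j)%:Z)%Z by rewrite abq dvdz_mulr.
  by rewrite dvdzE abszM /= Gauss_dvdr // coprime_sym.
split=> //.
have qE : q = a%:Z * (num_high j %/ b)%N%:Z.
  apply: (mulfI nzb); rewrite -abq mulrCA; congr (_ * _).
  by rewrite -PoszM mulnC divnK.
have -> : z = eps%:~R * y - (eps * r)%:~R.
  rewrite /y mulrA -rmorphM -[eps * eps]mulr1 -mulrA epsK mul1r.
  by rewrite addrK.
by rewrite yq qE; ring.
Qed.

(** Inverting the transform of the fiber sizes at [x] gives [a * #|fiber x| = b * y] with [y] an
    algebraic integer. *)
Lemma fiber_dvd x : x \in N -> x != 1%g -> (b %| #|fiber x|)%N.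
Proof.
move=> Nx nx.
have := fourier_inversion abN (fun x => #|fiber x|%:Z%:~R) Nx.
under eq_bigr => j _ do rewrite fiber_fourier.
rewrite (bigD1 0) //= irr0 cfun1E groupV Nx mulr1.
have -> : prod_sum 0 0 = (r * ((a * b)%N%:Z - eps))%:~R.
  rewrite /prod_sum !irr0 cfDprod_cfun1 -cardD -pmulrn -sum1_card natr_sum.
  by apply: eq_bigr => g /(subsetP sDG) Gg; rewrite cfun1E Gg.
rewrite (eq_bigr (fun j => (- (eps * r))%:~R * 'chi_j x^-1%g
    + (eps * (a * b)%N%:Z)%:~R * ((high j 0)%:R * 'chi_j x^-1%g))); last first.
  by move=> j nz; rewrite prod_sumE ?nz //; ring.
rewrite big_split /= -!mulr_sumr.
(* This value makes the terms [eps * r] cancel, so that [a * b] factors out of the inversion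
   formula. *)
have -> : \sum_(j < Nirr N | j != 0) 'chi_j x^-1%g = - 1.
  have := sum_irr_abelian abN x^-1%g; rewrite (bigD1 0) //= irr0 cfun1E groupV Nx.
  by rewrite invg_eq1 (negPf nx) => /eqP; rewrite addrC addr_eq0 => /eqP.
set z := \sum_(j | _) _ => e.
have Az : z \in Aint.
  by apply: rpred_sum => j _; rewrite rpredM ?Aint_irr ?rpred_nat.
pose y : algC := r%:~R + eps%:~R * z.
have Ay : y \in Aint by rewrite rpredD ?rpredM ?rpred_int.
have nzb : b%:Z != 0 by rewrite eqz_nat -lt0n.
have nzaC : (a%:Z%:~R : algC) != 0 by rewrite intr_eq0 eqz_nat -lt0n.
have ey : (a%:Z * #|fiber x|%:Z)%:~R = (b%:Z)%:~R * y.
  apply: (mulfI nzaC); transitivity (#|N|%:R * #|fiber x|%:~R : algC).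
    by rewrite oN; ring.
  by rewrite -e /y; ring.
have [q [_ abq]] := Aint_int_dvdz nzb Ay ey.
have : (b%:Z %| a%:Z * #|fiber x|%:Z)%Z by rewrite abq dvdz_mulr.
by rewrite dvdzE abszM /= Gauss_dvdr // coprime_sym.
Qed.

(** * Moments and quadratic forms of the two integer families *)

Let i (j : Iirr N) := (num_high j %/ b)%N.
Let e (x : gT) := (#|fiber x| %/ b)%N.
Let C : int := (a ^ 2)%N%:Z - 1.
Let k1 : int := \sum_(x in N) (x \in D)%:Z.
Let d1 : int := #|fiber 1%g|%:Z.
(** Divisibility by [b] is established away from the trivial index only, so the sums of [i] and [e]
    omit it. *)
Let I1 : int := \sum_(j | j != 0) (i j)%:Z.
Let I2 : int := \sum_(j | j != 0) (i j)%:Z ^+ 2.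
Let S : int := \sum_(j : Iirr N | j != 0) (high j 0)%:Z.
Let E1 : int := \sum_(x in N | x != 1%g) (e x)%:Z.
Let E2 : int := \sum_(x in N | x != 1%g) (e x)%:Z ^+ 2.

Let cardI : #|[pred j : Iirr N | j != 0]|%:Z = C.
Proof.
have := cardC1 (0 : Iirr N); rewrite card_Iirr_abelian // oN => cI.
rewrite (_ : #|_| = (a ^ 2).-1); last first.
  by rewrite -cI; apply: eq_card => j; rewrite !inE.
by rewrite -subn1 -subzn // expn_gt0 a0.
Qed.

Let cardN1 : #|[pred x in N | x != 1%g]|%:Z = C.
Proof.
have := cardsD1 1%g N; rewrite group1 oN /C => ->.
rewrite PoszD addrAC subrr add0r; congr (Posz _).
by apply: eq_card => x; rewrite !inE andbC.
Qed.

Let odd_i j : j != 0 -> odd (i j) = high j 0.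
Proof.
move=> nz; have [bh _] := inter_value nz.
by rewrite -odd_num_high -[in RHS](divnK bh) oddM odd_b andbT.
Qed.

Let fiberE x : x \in N -> x != 1%g -> #|fiber x| = (b * e x)%N.
Proof. by move=> Nx nx; rewrite mulnC divnK ?fiber_dvd. Qed.

Let odd_e x : x \in N -> x != 1%g -> odd (e x) = (x \in D).
Proof. by move=> Nx nx; rewrite -odd_fiber // fiberE // oddM odd_b. Qed.

Let sum_fiber : \sum_(x in N) #|fiber x|%:Z = r * ((a * b)%N%:Z - eps).
Proof.
rewrite -cardD; apply: (@intr_inj algC).
have := fiber_fourier 0; rewrite /prod_sum !irr0 cfDprod_cfun1.
rewrite rmorph_sum /= => h.
transitivity (\sum_(x in N) #|fiber x|%:Z%:~R * (1 : 'CF(N)) x : algC).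
  by apply: eq_bigr => x Nx; rewrite cfun1E Nx mulr1.
rewrite h -pmulrn -sum1_card natr_sum.
by apply: eq_bigr => g /(subsetP sDG) Gg; rewrite cfun1E Gg.
Qed.

(** [fourier_moments] for the indicator of [D] on [N], which is its own square and vanishes at the
    identity. *)
Let D_moments : k1 - C * (eps * r) + eps * a%:Z * I1 = 0 /\
  k1 ^+ 2 + C * (eps * r) ^+ 2 - 2 * (eps * r) * (eps * a%:Z) * I1
    + (eps * a%:Z) ^+ 2 * I2 = (a ^ 2)%N%:Z * k1.
Proof.
have := @fourier_moments _ _ abN (fun x => (x \in D)%:Z) (- (eps * r))
  (eps * a%:Z) (fun j => (i j)%:Z) (fun j nz => proj2 (inter_value nz)).
rewrite oN (negPf D1) mulr0 sum_affine sum_sqr_affine cardI -/I1 -/I2.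
have -> : \sum_(x in N) (x \in D)%:Z ^+ 2 = k1.
  by apply: eq_bigr => x _; case: (x \in D).
rewrite -/k1 => -[h1 h2]; split; first by rewrite -[RHS]h1; ring.
by rewrite -h2; ring.
Qed.

(** [fourier_moments] for the fiber sizes; [high j 0] is its own square, so [S] serves both
    moments. *)
Let fiber_moments :
  r * ((a * b)%N%:Z - eps) - C * (eps * r) + eps * (a * b)%N%:Z * S
    = (a ^ 2)%N%:Z * d1 /\
  (r * ((a * b)%N%:Z - eps)) ^+ 2 + C * (eps * r) ^+ 2
    - 2 * (eps * r) * (eps * (a * b)%N%:Z) * S
    + (eps * (a * b)%N%:Z) ^+ 2 * S = (a ^ 2)%N%:Z * (d1 ^+ 2 + b%:Z ^+ 2 * E2).
Proof.
have fib j : j != 0 -> \sum_(x in N) #|fiber x|%:~R * 'chi_j x =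
    (- (eps * r) + eps * (a * b)%N%:Z * (high j 0)%:Z)%:~R.
  by move=> nz; rewrite fiber_fourier prod_sumE ?nz.
have := fourier_moments abN fib.
rewrite oN -/d1 sum_fiber sum_affine sum_sqr_affine cardI -/S.
have -> : \sum_(j : Iirr N | j != 0) (high j 0)%:Z ^+ 2 = S.
  by apply: eq_bigr => j _; case: (high j 0).
have -> : \sum_(x in N) #|fiber x|%:Z ^+ 2 = d1 ^+ 2 + b%:Z ^+ 2 * E2.
  rewrite (bigD1 1%g) //=; congr (_ + _); rewrite mulr_sumr.
  by apply: eq_bigr => x /andP[Nx nx]; rewrite fiberE // PoszM exprMn.
move=> [<- <-]; split; ring.
Qed.

Let fiber_total : r * ((a * b)%N%:Z - eps) = d1 + b%:Z * E1.
Proof.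
rewrite -sum_fiber (bigD1 1%g) //= mulr_sumr; congr (_ + _).
by apply: eq_bigr => x /andP[Nx nx]; rewrite fiberE.
Qed.

(** The case [j = 0] of [inter_fourier]: [J] counts the nontrivial characters of [M] related to the
    trivial one of [N]. *)
Let trivial_bound : exists2 J : int, 0 <= J <= (b ^ 2)%N%:Z - 1 &
  (b ^ 2)%N%:Z * k1 = r * ((a * b)%N%:Z - eps) - ((b ^ 2)%N%:Z - 1) * (eps * r)
                      + eps * (a * b)%N%:Z * J.
Proof.
have cardJ : #|[pred l : Iirr M | l != 0]| = (b ^ 2).-1.
  have := cardC1 (0 : Iirr M); rewrite card_Iirr_abelian // oM => <-.
  by apply: eq_card => l; rewrite !inE.
have b2 : (b ^ 2).-1%:Z = (b ^ 2)%N%:Z - 1.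
  by rewrite -subn1 -subzn // expn_gt0 b0.
exists #|[set l | (l != 0) & high 0 l]|%:Z.
  rewrite -b2 -cardJ lez_nat /=; apply: subset_leq_card.
  by apply/subsetP=> l; rewrite !inE => /andP[].
apply: (@intr_inj algC).
have := inter_fourier 0; rewrite (bigD1 0) //= sum_high; last first.
  by move=> l ->; rewrite orbT.
rewrite cardJ b2 -fiber_fourier irr0.
have -> : \sum_(x in N) #|fiber x|%:Z%:~R * (1 : 'CF(N)) x
    = (r * ((a * b)%N%:Z - eps))%:~R :> algC.
  rewrite -sum_fiber rmorph_sum /=; apply: eq_bigr => x Nx.
  by rewrite cfun1E Nx mulr1.
have -> : \sum_(x in N) (x \in D)%:Z%:~R * (1 : 'CF(N)) x = k1%:~R :> algC.
  by rewrite rmorph_sum /=; apply: eq_bigr => x Nx; rewrite cfun1E Nx mulr1.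
move=> h; transitivity ((b ^ 2)%:R * k1%:~R : algC); first by ring.
by rewrite -h; ring.
Qed.

(* An integer of odd parity has square at least 1. *)
Let square_forms (p : int) :
  (~~ odd `|p|%N -> 0 <= I2 - 2 * p * I1 + p ^+ 2 * C - S
     /\ 0 <= E2 - 2 * p * E1 + p ^+ 2 * C - k1) /\
  (odd `|p|%N -> 0 <= I2 - 2 * p * I1 + p ^+ 2 * C - (C - S)
     /\ 0 <= E2 - 2 * p * E1 + p ^+ 2 * C - (C - k1)).
Proof.
have k1E : k1 = \sum_(x in N | x != 1%g) (x \in D)%:Z.
  by rewrite /k1 (bigD1 1%g) //= (negPf D1) add0r.
have sqI : I2 - 2 * p * I1 + p ^+ 2 * C
    = \sum_(j | j != 0) (- p + 1 * (i j)%:Z) ^+ 2.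
  by rewrite sum_sqr_affine cardI -/I1 -/I2; ring.
have sqE : E2 - 2 * p * E1 + p ^+ 2 * C
    = \sum_(x in N | x != 1%g) (- p + 1 * (e x)%:Z) ^+ 2.
  by rewrite sum_sqr_affine cardN1 -/E1 -/E2; ring.
have CS : C - S = \sum_(j : Iirr N | j != 0) (~~ high j 0)%:Z.
  rewrite -cardI -[#|_|%:Z]natz -sumr_const -sumrB.
  by apply: eq_bigr => j _; case: (high j 0).
have Ck : C - k1 = \sum_(x in N | x != 1%g) (x \notin D)%:Z.
  rewrite k1E -cardN1 -[#|_|%:Z]natz -sumr_const -sumrB.
  by apply: eq_bigr => x _; case: (x \in D).
rewrite sqI sqE CS Ck k1E -!sumrB.
split=> par; split; apply: sumr_ge0 => x;
  rewrite mul1r [- p + _]addrC => Px; apply: sqr_sub_parity_ge.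
- by rewrite odd_i // (negPf par) addbF.
- by case/andP: Px => Nx nx; rewrite odd_e // (negPf par) addbF.
- by rewrite odd_i // par addbT.
by case/andP: Px => Nx nx; rewrite odd_e // par addbT.
Qed.

Let consecutive_forms (f : int) :
  0 <= I2 - (2 * f + 1) * I1 + f * (f + 1) * C /\
  0 <= E2 - (2 * f + 1) * E1 + f * (f + 1) * C.
Proof.
have gen (I : finType) (P : pred I) (u : I -> int) :
    0 <= \sum_(x | P x) u x ^+ 2 - (2 * f + 1) * \sum_(x | P x) u x
         + f * (f + 1) * #|P|%:Z.
  have -> : \sum_(x | P x) u x ^+ 2 - (2 * f + 1) * \sum_(x | P x) u x
      + f * (f + 1) * #|P|%:Z = \sum_(x | P x) (u x - f) * (u x - f - 1).
    rewrite -[#|P|%:Z]natz mulr_natr -sumr_const mulr_sumr.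
    rewrite -sumrB -big_split /=.
    by apply: eq_bigr => x _; ring.
  by apply: sumr_ge0 => x _; apply: mul_sub_succ_ge0.
split.
  by have := gen _ [pred j : Iirr N | j != 0] (fun j => (i j)%:Z); rewrite cardI.
by have := gen _ [pred x in N | x != 1%g] (fun x => (e x)%:Z); rewrite cardN1.
Qed.

Lemma split_dichotomy (f : int) :
  0 <= r - f * a%:Z -> eps <= r - f * a%:Z ->
  r - f * a%:Z <= a%:Z -> r - f * a%:Z <= a%:Z + eps ->
  exists2 A : int, 0 <= eps * (b%:Z * A - r) <= (b ^ 2)%N%:Z - 1 &
    A - eps * f = r - f * a%:Z \/ A - eps * f = a%:Z + eps - (r - f * a%:Z).
Proof.
move=> r1 r2 r3 r4.
have toQ (x y : int) : x = y -> x%:~R = y%:~R :> rat by move->.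
have leQ (x y : int) : x <= y -> (x%:~R : rat) <= y%:~R by rewrite ler_int.
have [/toQ m1 /toQ m2] := D_moments; have [/toQ m3 /toQ m4] := fiber_moments.
have /toQ m5 := fiber_total.
have [/leQ cI /leQ cE] := consecutive_forms f.
have [A [kA dA]] : exists A : rat, k1%:~R = a%:R * A - eps%:~R * r%:~R /\
    (A - eps%:~R * f%:~R = r%:~R - f%:~R * a%:R \/
     A - eps%:~R * f%:~R = a%:R + eps%:~R - (r%:~R - f%:~R * a%:R)).
  apply: (@moments_dichotomy _ b%:R _ _ _ d1%:~R I1%:~R I2%:~R S%:~R E1%:~R E2%:~R).
  - by rewrite ltr0n.
  - by rewrite ltr0n.
  - by case: heps => ->; [left | right].
  - by apply: (etrans _ (etrans m1 _)); rewrite /C; ring.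
  - apply: (etrans _ (etrans m2 _)); last by ring.
    by case: heps => ->; rewrite /C; ring.
  - by apply: (etrans _ (etrans m3 _)); rewrite /C; ring.
  - apply: (etrans _ (etrans m4 _)); last by ring.
    by case: heps => ->; rewrite /C; ring.
  - by apply: (etrans _ (etrans m5 _)); ring.
  - by move: cI; rewrite /C; lra.
  - by move: cE; rewrite /C; lra.
  - have [ev od] := square_forms f; have [ev1 od1] := square_forms (f + 1).
    rewrite odd_abszS negbK in ev1 od1.
    case: (boolP (odd `|f|%N)) => par; [right|left]; split.
    + by have [/leQ + /leQ] := od par; rewrite /C; lra.
    + by have [/leQ + /leQ] := ev1 par; rewrite /C; lra.
    + by have [/leQ + /leQ] := ev par; rewrite /C; lra.
    by have [/leQ + /leQ] := od1 par; rewrite /C; lra.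
  - by have := leQ _ _ r1; lra.
  - by have := leQ _ _ r2; lra.
  - by have := leQ _ _ r3; lra.
  - by have := leQ _ _ r4; lra.
(* Either alternative expresses [A] through integers. *)
have [A' AE] : exists A' : int, A = A'%:~R.
  by case: dA => dA; [exists (eps * f + (r - f * a%:Z))
                    | exists (eps * f + (a%:Z + eps - (r - f * a%:Z)))]; lra.
rewrite {}AE in kA dA; exists A'; last first.
  by case: dA => dA; [left | right]; apply: (@intr_inj rat); lra.
have [J J_bound hJ] := trivial_bound.
have {}kA : k1 = a%:Z * A' - eps * r by apply: (@intr_inj rat); rewrite kA; ring.
suff -> : eps * (b%:Z * A' - r) = J by [].
(* Substituting [k1 = a * A' - eps * r] in [hJ] gives this equation multiplied by [a * b]. *)
have -> : b%:Z * A' - r = eps * J; last exact: epsK.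
have nz : (a * b)%N%:Z != 0 by rewrite eqz_nat -lt0n muln_gt0 a0 b0.
apply: (mulfI nz); move: hJ; rewrite kA => /eqP; rewrite -subr_eq0 => /eqP hJ.
by apply/eqP; rewrite -subr_eq0 -[X in _ == X]hJ; apply/eqP; ring.
Qed.

End CoprimeSplit.

(** * From the two values of [A] to the bounds on [r] *)

Lemma floor_half_eq0 (a t : int) :
  0 < a -> t * (2 * a) <= a -> a < (t + 1) * (2 * a) -> t = 0.
Proof.
move=> a0 t_le t_gt.
have t_lt1 : t < 1 by have [//|t1] := ltrP t 1; nra.
have t1_gt0 : 0 < t + 1 by have [//|t1] := ltrP 0 (t + 1); nra.
by lia.
Qed.

(** The two values of [A] turn [b * A - r] into [(b - 1) * (r - Y)] and [(b + 1) * (X - r)]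
    respectively. *)
Lemma latin_square_bounds (a b t r f A : rat) : 1 < b -> 2 * f = b - 1 - 2 * t ->
  0 <= b * A - r <= b ^+ 2 - 1 ->
  A - f = r - f * a \/ A - f = a + 1 - (r - f * a) ->
  let X := (a + 1) * b * (b + 1 - 2 * t) / (2 * (b + 1)) in
  let Y := (a - 1) * b * (b - 1 - 2 * t) / (2 * (b - 1)) in
  (X - (b - 1) <= r <= X) \/ (Y <= r <= Y + (b + 1)).
Proof.
move=> b1 ef /andP[h1 h2] hA X Y.
have bp : 0 < b + 1 by lra.
have bm : 0 < b - 1 by lra.
have XE : X * (b + 1) = (a + 1) * b * (f + 1).
  by rewrite /X (_ : t = (b - 1 - 2 * f) / 2); [field; lra | lra].
have YE : Y * (b - 1) = (a - 1) * b * f.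
  by rewrite /Y (_ : t = (b - 1 - 2 * f) / 2); [field; lra | lra].
case: hA => hA; [right|left]; apply/andP; split.
- by rewrite -(ler_pM2r bm) YE; nra.
- by rewrite -(ler_pM2r bm) mulrDl YE; nra.
- by rewrite -(ler_pM2r bp) mulrBl XE; nra.
by rewrite -(ler_pM2r bp) XE; nra.
Qed.

(** Here [r - b * A] becomes [(b - 1) * (X - r)] and [(b + 1) * (r - Y)] respectively. *)
Lemma negative_latin_square_bounds (a b t r f A : rat) :
  1 < b -> 2 * f = b - 1 + 2 * t ->
  0 <= r - b * A <= b ^+ 2 - 1 ->
  A + f = r - f * a \/ A + f = a - 1 - (r - f * a) ->
  let X := (a + 1) * b * (b - 1 + 2 * t) / (2 * (b - 1)) in
  let Y := (a - 1) * b * (b + 1 + 2 * t) / (2 * (b + 1)) in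
  (X - (b + 1) <= r <= X) \/ (Y <= r <= Y + (b - 1)).
Proof.
move=> b1 ef /andP[h1 h2] hA X Y.
have bp : 0 < b + 1 by lra.
have bm : 0 < b - 1 by lra.
have XE : X * (b - 1) = (a + 1) * b * f.
  by rewrite /X (_ : t = (2 * f - b + 1) / 2); [field; lra | lra].
have YE : Y * (b + 1) = (a - 1) * b * (f + 1).
  by rewrite /Y (_ : t = (2 * f - b + 1) / 2); [field; lra | lra].
case: hA => hA; [left|right]; apply/andP; split.
- by rewrite -(ler_pM2r bm) mulrBl XE; nra.
- by rewrite -(ler_pM2r bm) XE; nra.
- by rewrite -(ler_pM2r bp) YE; nra.
by rewrite -(ler_pM2r bp) mulrDl YE; nra.
Qed.

(** With [t = 0] the bound [X] exceeds [a * b / 2] by exactly [b / 2], which is at most [b - 1]. *)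
Lemma latin_square_bounds_half (a b X : rat) :
  2 <= b -> X = (a + 1) * b * (b + 1 - 2 * 0) / (2 * (b + 1)) ->
  X - (b - 1) <= a * b / 2 <= X.
Proof.
move=> b2 XE; have {}XE : X = (a + 1) * b / 2 by rewrite XE; field; lra.
by apply/andP; split; lra.
Qed.

Lemma negative_latin_square_bounds_half (a b X : rat) :
  2 <= b -> X = (a + 1) * b * (b - 1 + 2 * 0) / (2 * (b - 1)) ->
  X - (b + 1) <= a * b / 2 <= X.
Proof.
move=> b2 XE; have {}XE : X = (a + 1) * b / 2 by rewrite XE; field; lra.
by apply/andP; split; lra.
Qed.

(** The floor condition is a half-open window for [r - f * a]: from 1 to [a] if [eps = 1], from 0 to
    [a - 1] if [eps = -1]. *)
Lemma floor_window (a n eps r t f : int) : eps = 1 \/ eps = -1 ->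
  2 * (f * a) = n - a - 2 * eps * t * a ->
  t * (2 * a) <= eps * n - 2%:Z * eps * r + a ->
  eps * n - 2%:Z * eps * r + a < (t + 1) * (2 * a) ->
  [/\ 0 <= r - f * a, eps <= r - f * a, r - f * a <= a & r - f * a <= a + eps].
Proof.
by move=> heps; move: (f * a) => fa; case: heps => -> *; split; lia.
Qed.

Lemma latin_PDS_dichotomy (gT : finGroupType) (G : {group gT}) (D : {set gT})
    (a b : nat) (eps r f : int) :
  abelian G -> #|G| = (a ^ 2 * b ^ 2)%N -> coprime a b -> (0 < a)%N -> odd b ->
  eps = 1 \/ eps = -1 ->
  is_PDS G D (a ^ 2 * b ^ 2)%N (r * ((a * b)%N%:Z - eps))
         (eps * (a * b)%N%:Z + r ^+ 2 - 3%:Z * eps * r) (r ^+ 2 - eps * r) ->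
  (a * b)%N%:Z != 2 * r ->
  0 <= r - f * a%:Z -> eps <= r - f * a%:Z ->
  r - f * a%:Z <= a%:Z -> r - f * a%:Z <= a%:Z + eps ->
  exists2 A : int, 0 <= eps * (b%:Z * A - r) <= (b ^ 2)%N%:Z - 1 &
    A - eps * f = r - f * a%:Z \/ A - eps * f = a%:Z + eps - (r - f * a%:Z).
Proof.
move=> abG oG co_ab a0 odd_b heps pdsD beta; have [sDG _ cardD _] := pdsD.
(* The difference of the two sides is [eps * (a * b - 2 * r)]. *)
have neq : eps * (a * b)%N%:Z + r ^+ 2 - 3%:Z * eps * r != r ^+ 2 - eps * r.
  apply: contraNneq beta => e; apply/eqP.
  by case: heps e => ->; lra.
have D1 : 1%g \notin D.
  apply: (PDS_1notin pdsD neq); rewrite !PoszM.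
  by case: heps => ->; ring.
have irrD (j : Iirr G) : j != 0 -> exists s : bool,
    \sum_(g in D) 'chi_j g = (- (eps * r) + eps * (a * b)%N%:Z * s%:Z)%:~R.
  move=> nz; have /= := PDS_irr_sq abG pdsD neq D1 nz; set S := \sum_(g in D) _.
  move=> SS.
  (* For these parameters the quadratic equation of [PDS_irr_sq] splits over the integers. *)
  have : (S + (eps * r)%:~R) * (S + (eps * r - eps * (a * b)%N%:Z)%:~R) = 0.
    rewrite mulrDl mulrDr SS.
    by case: heps => ->; ring.
  move/eqP; rewrite mulf_eq0 !addr_eq0 => /orP[] /eqP->.
    by exists false; rewrite mulr0 addr0 rmorphN.
  by exists true; rewrite mulr1; ring.
have co2 : coprime (a ^ 2) (b ^ 2) by rewrite coprimeXl // coprimeXr.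
have [N [M [NxM oN oM]]] := abelian_coprime_dprod abG oG co2.
exact: (split_dichotomy abG NxM oN oM co_ab a0 odd_b heps sDG D1 cardD irrD).
Qed.

Unset Implicit Arguments.

Theorem theorem2 (gT : finGroupType) (G : {group gT}) (D : {set gT})
    (a b : nat) (eps r t : int) :
  abelian G -> #|G| = (a ^ 2 * b ^ 2)%N ->
  coprime a b -> (1 < a)%N -> odd b -> (3 <= b)%N ->
  (eps = 1 \/ eps = -1) ->
  is_PDS G D (a ^ 2 * b ^ 2)%N (r * ((a * b)%N%:Z - eps))
         (eps * (a * b)%N%:Z + r ^+ 2 - 3%:Z * eps * r) (r ^+ 2 - eps * r) ->
  (t%:~R <= ((eps * (a * b)%N%:Z - 2%:Z * eps * r + a%:Z)%:~R / (2 * a%:R) : rat)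
   /\ ((eps * (a * b)%N%:Z - 2%:Z * eps * r + a%:Z)%:~R / (2 * a%:R) : rat)
       < (t + 1)%:~R) ->
  (eps = 1 ->
     let X : rat := (a%:R + 1) * b%:R * (b%:R + 1 - 2 * t%:~R) / (2 * (b%:R + 1)) in
     let Y : rat := (a%:R - 1) * b%:R * (b%:R - 1 - 2 * t%:~R) / (2 * (b%:R - 1)) in
     (X - (b%:R - 1) <= r%:~R <= X) \/ (Y <= r%:~R <= Y + (b%:R + 1))) /\
  (eps = -1 ->
     let X : rat := (a%:R + 1) * b%:R * (b%:R - 1 + 2 * t%:~R) / (2 * (b%:R - 1)) in
     let Y : rat := (a%:R - 1) * b%:R * (b%:R + 1 + 2 * t%:~R) / (2 * (b%:R + 1)) in
     (X - (b%:R + 1) <= r%:~R <= X) \/ (Y <= r%:~R <= Y + (b%:R - 1))).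
Proof.
move=> abG oG co_ab a1 odd_b b3 heps pdsD [t_le t_gt].
have a0 : (0 < a)%N by apply: ltnW.
have aQ : (0 : rat) < a%:R by rewrite ltr0n.
have bQ2 : (2 : rat) <= b%:R by rewrite ler_nat; apply: ltnW.
have bQ : (1 : rat) < b%:R by rewrite ltr1n; apply: ltnW.
rewrite ler_pdivlMr in t_le; last by rewrite mulr_gt0.
rewrite ltr_pdivrMr in t_gt; last by rewrite mulr_gt0.
have {}t_le : t * (2 * a%:Z) <= eps * (a * b)%N%:Z - 2%:Z * eps * r + a%:Z.
  by rewrite -(ler_int rat); lra.
have {}t_gt : eps * (a * b)%N%:Z - 2%:Z * eps * r + a%:Z < (t + 1) * (2 * a%:Z).
  by rewrite -(ltr_int rat); lra.
(* Equality means [lam = mu], where the character argument breaks down; then the quotient bounding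
   [t] is one half. *)
have [half | beta] := eqVneq (a * b)%N%:Z (2 * r).
  have t0 : t = 0.
    have e0 : eps * (a * b)%N%:Z - 2%:Z * eps * r + a%:Z = a%:Z.
      by rewrite half; ring.
    by rewrite e0 in t_le t_gt; apply: (@floor_half_eq0 a%:Z).
  have rE : r%:~R = a%:R * b%:R / 2 :> rat.
    by have := congr1 (fun n : int => n%:~R : rat) half; rewrite PoszM; lra.
  split=> _ X Y; left; rewrite rE.
    by apply: latin_square_bounds_half; rewrite /X ?t0.
  by apply: negative_latin_square_bounds_half; rewrite /X ?t0.
(* For odd [b], [b./2] is [(b - 1) / 2]. *)
pose f : int := b./2%:Z - eps * t.
have fE : 2 * f = b%:Z - 1 - 2 * eps * t.
  have bE : b%:Z = 1 + b./2%:Z * 2.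
    by rewrite -{1}(odd_double_half b) odd_b PoszD -muln2 PoszM.
  by rewrite /f bE; ring.
have faE : 2 * (f * a%:Z) = (a * b)%N%:Z - a%:Z - 2 * eps * t * a%:Z.
  by rewrite mulrA fE PoszM; ring.
have [r1 r2 r3 r4] := floor_window heps faE t_le t_gt.
have [A A_bound A_val] := latin_PDS_dichotomy abG oG co_ab a0 odd_b heps pdsD beta
  r1 r2 r3 r4.
have intQ (x y : int) : x = y -> x%:~R = y%:~R :> rat by move->.
case/andP: A_bound; rewrite -!(ler_int rat) => A1 A2.
have {}fE := intQ _ _ fE.
split=> e1; rewrite {}e1 in A1 A2 A_val fE.
  apply: (@latin_square_bounds _ _ _ _ f%:~R A%:~R) => //.
  - by lra.
  - by apply/andP; split; lra.
  by case: A_val => /intQ h; [left | right]; lra.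
apply: (@negative_latin_square_bounds _ _ _ _ f%:~R A%:~R) => //.
- by lra.
- by apply/andP; split; lra.
by case: A_val => /intQ h; [left | right]; lra.
Qed.
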